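(* Let $\mu>0$, $\rho_\pm>0$ and $u_\pm\in\mathbb{R}$ be fixed with $u_-<u_+$. For $k_1,k_2>0$ such that $(\rho_+,u_+)\in I(\rho_-,u_-)$, consider the two-rarefaction-wave ($R_1+R_2$) Riemann solution of $$\begin{cases}\rho_t+(\rho u)_x=0,\\ (\rho u)_t+\left(-\dfrac{k_1}{\rho}+\rho u^2+\dfrac{k_2^2\rho^2}{2\mu}\right)_x=0,\end{cases}\qquad (\rho,u)(x,0)=(\rho_\pm,u_\pm)\ \text{ for }\ \pm x>0 .$$ Then, as $k_1,k_2\to0$, the limit of this Riemann solution is the Riemann solution, with the same initial data, of the transport equations for zero pressure flow $$\rho_t+(\rho u)_x=0,\qquad(\rho u)_t+(\rho u^2)_x=0,$$ which contains two contact discontinuities $\xi=x/t=u_\pm$ and a vacuum state besides the two constant states $(\rho_\pm,u_\pm)$.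
   Context: Put $w(\rho)=\sqrt{k_1/\rho^2+k_2^2\rho/\mu}$, $\lambda_1=u-w(\rho)$, $\lambda_2=u+w(\rho)$. The region $I(\rho_-,u_-)$ (depending on $k_1,k_2$) is the set of $(\rho,u)$ with $\rho>0$ lying on the large-$u$ side of the rarefaction curves $R_1$ and $R_2$ through $(\rho_-,u_-)$, i.e. $u>u_-+\left|\int_{\rho_-}^{\rho}\frac{w(s)}{s}\,ds\right|$. For $(\rho_+,u_+)\in I(\rho_-,u_-)$ the Riemann solution is a function of $\xi=x/t$ consisting of the constant state $(\rho_-,u_-)$, a rarefaction wave $R_1$, a constant intermediate state $(\rho_*,u_* )$ with $0<\rho_*\le\min(\rho_-,\rho_+)$, a rarefaction wave $R_2$, and the constant state $(\rho_+,u_+)$, where $$R_1:\ \xi=\lambda_1=u-w(\rho),\quad u=u_--\int_{\rho_-}^{\rho}\frac{w(s)}{s}\,ds,\quad \rho_*\le\rho\le\rho_-,$$ $$R_2:\ \xi=\lambda_2=u+w(\rho),\quad u=u_++\int_{\rho_+}^{\rho}\frac{w(s)}{s}\,ds,\quad \rho_*\le\rho\le\rho_+ .$$ For $u_-<u_+$ the Riemann solution of the transport equations is, with $\xi=x/t$, $$(\rho,u)(\xi)=\begin{cases}(\rho_-,u_-),&-\infty<\xi<u_-,\\(0,\xi),&u_-\le\xi\le u_+,\\(\rho_+,u_+),&u_+<\xi<+\infty,\end{cases}$$ where the middle part ($\rho=0$) is called the vacuum state. The limit $k_1,k_2\to0$ is the limit $(k_1,k_2)\to(0,0)$ through positive values,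 with $\mu,\rho_\pm,u_\pm$ fixed, and is understood pointwise in $\xi$ for $\xi\neq u_\pm$.
   Formalization: In the vacuum u_- < xi < u_+ the claim u -> xi is false (there u -> (u_- + u_+)/2), so only the limits of rho, rho u and rho u^2 are asserted there; outside the vacuum both rho and u converge. *)

(* Defs.v *)
From Stdlib Require Import Reals Lra.
From Coquelicot Require Import Coquelicot.
Open Scope R_scope.

Definition pressure (mu k1 k2 rho : R) : R :=
  - k1 / rho + k2 ^ 2 * rho ^ 2 / (2 * mu).

Definition w (mu k1 k2 rho : R) : R :=
  sqrt (k1 / rho ^ 2 + k2 ^ 2 * rho / mu).

Lemma pressure_derive (mu k1 k2 rho : R) :
  0 < mu -> 0 < k1 -> 0 < k2 -> 0 < rho ->
  is_derive (pressure mu k1 k2) rho (w mu k1 k2 rho ^ 2).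
Proof.
intros Hmu Hk1 Hk2 Hrho.
unfold pressure, w.
rewrite pow2_sqrt.
- auto_derive; [lra | field; lra].
- apply Rplus_le_le_0_compat; apply Rlt_le.
  + apply Rdiv_lt_0_compat; [lra | now apply pow_lt].
  + apply Rdiv_lt_0_compat; [|lra].
    apply Rmult_lt_0_compat; [now apply pow_lt | lra].
Qed.

Definition lambda1 (mu k1 k2 rho u : R) : R := u - w mu k1 k2 rho.
Definition lambda2 (mu k1 k2 rho u : R) : R := u + w mu k1 k2 rho.

(* [RInt] is oriented: for b < a it is minus the integral over [b, a]. *)
Definition wave_int (mu k1 k2 a b : R) : R :=
  RInt (fun s => w mu k1 k2 s / s) a b.

Definition region_I (mu k1 k2 rhom um rho u : R) : Prop :=
  0 < rho /\ u > um + Rabs (wave_int mu k1 k2 rhom rho).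

(* [rho] and [u] are functions of xi = x / t.  The solution is continuous, so
   the closed ranges of xi below overlap consistently at the wave edges. *)
Definition two_rarefaction_solution
    (mu k1 k2 rhom um rhop up : R) (rho u : R -> R) : Prop :=
  exists rhos us : R,
    0 < rhos <= Rmin rhom rhop /\
    us = um - wave_int mu k1 k2 rhom rhos /\
    us = up + wave_int mu k1 k2 rhop rhos /\
    (forall xi, xi <= lambda1 mu k1 k2 rhom um ->
       rho xi = rhom /\ u xi = um) /\
    (forall xi,
       lambda1 mu k1 k2 rhom um <= xi <= lambda1 mu k1 k2 rhos us ->
       rhos <= rho xi <= rhom /\
       xi = lambda1 mu k1 k2 (rho xi) (u xi) /\
       u xi = um - wave_int mu k1 k2 rhom (rho xi)) /\
    (forall xi,
       lambda1 mu k1 k2 rhos us <= xi <= lambda2 mu k1 k2 rhos us ->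
       rho xi = rhos /\ u xi = us) /\
    (forall xi,
       lambda2 mu k1 k2 rhos us <= xi <= lambda2 mu k1 k2 rhop up ->
       rhos <= rho xi <= rhop /\
       xi = lambda2 mu k1 k2 (rho xi) (u xi) /\
       u xi = up + wave_int mu k1 k2 rhop (rho xi)) /\
    (forall xi, lambda2 mu k1 k2 rhop up <= xi ->
       rho xi = rhop /\ u xi = up).

Definition transport_rho (rhom um rhop up xi : R) : R :=
  if Rlt_dec xi um then rhom else if Rle_dec xi up then 0 else rhop.

Definition transport_u (um up xi : R) : R :=
  if Rlt_dec xi um then um else if Rle_dec xi up then xi else up.

Definition k_to_0 : (R * R -> Prop) -> Prop :=
  within (fun k : R * R => 0 < fst k /\ 0 < snd k) (locally (0, 0)).

(* Convergence of flow states: density and velocity converge, except that at a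
   vacuum limit (rho0 = 0) the velocity is seen only through the quantities
   rho u and rho u^2 of the transport equations.  Requiring u -> u0 in the
   vacuum would be false for two-rarefaction solutions: there the density of the
   constant intermediate state tends to 0 and its velocity to (um + up) / 2,
   whatever xi, whereas the transport solution has the conventional value xi. *)
Definition flow_cvg {K : Type} (F : (K -> Prop) -> Prop)
    (rho u : K -> R) (rho0 u0 : R) : Prop :=
  filterlim rho F (locally rho0) /\
  (rho0 <> 0 -> filterlim u F (locally u0)) /\
  filterlim (fun k => rho k * u k) F (locally (rho0 * u0)) /\
  filterlim (fun k => rho k * u k ^ 2) F (locally (rho0 * u0 ^ 2)).

(* Main.v *)
(** The speed [w] tends to 0 with [(k1, k2)], uniformly on compact subsets of
    [rho > 0], hence so do the wave integrals over such subsets.  So the outer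
    edges of the fan tend to [um] and [up].  For [um < xi < up], in each of the
    three inner pieces of the solution some wave integral from the density at
    [xi] up to [rhom] or [rhop] stays bounded below by a positive constant
    depending only on [xi]; this forces the density at [xi] to 0, while the
    velocity stays in [[um, up]]. *)
Require Import Defs.
From Stdlib Require Import Reals Lra.
From Coquelicot Require Import Coquelicot.
Open Scope R_scope.

(** * Convergence of flow states along a filter *)

Lemma flow_cvg_eventually_eq {K : Type} (F : (K -> Prop) -> Prop) {FF : Filter F}
    (rho u : K -> R) (rho0 u0 : R) :
  F (fun k => rho k = rho0 /\ u k = u0) -> flow_cvg F rho u rho0 u0.
Proof.
intros H.
(* The state is eventually constant, so any [f], continuous or not, passes to the limit; the
   components of [flow_cvg] are instances. *)
assert (E : forall f : R -> R -> R,
  filterlim (fun k => f (rho k) (u k)) F (locally (f rho0 u0))).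
{ intros f; apply filterlim_locally; intros eps.
  revert H; apply filter_imp; intros k [-> ->]; apply ball_center. }
repeat split.
- exact (E (fun r _ => r)).
- intros _; exact (E (fun _ v => v)).
- exact (E (fun r v => r * v)).
- exact (E (fun r v => r * v ^ 2)).
Qed.

Lemma filterlim_mult_bounded_0 {K : Type} (F : (K -> Prop) -> Prop) {FF : Filter F}
    (f g : K -> R) (M : R) :
  filterlim f F (locally 0) -> F (fun k => Rabs (g k) <= M) ->
  filterlim (fun k => f k * g k) F (locally 0).
Proof.
intros Hf Hg; apply filterlim_locally; intros eps.
assert (HM : 0 < Rabs M + 1) by (pose proof (Rabs_pos M); lra).
pose (d := mkposreal (eps / (Rabs M + 1)) (Rdiv_lt_0_compat _ _ (cond_pos eps) HM)).
generalize (filter_and _ _ (proj1 (filterlim_locally f 0) Hf d) Hg).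
apply filter_imp; intros k [Hd HgM].
change (Rabs (f k - 0) < d) in Hd; change (Rabs (f k * g k - 0) < eps).
rewrite Rminus_0_r in Hd |- *; rewrite Rabs_mult.
replace (pos eps) with (d * (Rabs M + 1)) by (unfold d; simpl; field; lra).
pose proof (Rle_abs M).
apply Rle_lt_trans with (Rabs (f k) * (Rabs M + 1)).
- apply Rmult_le_compat_l; [apply Rabs_pos | lra].
- now apply Rmult_lt_compat_r.
Qed.

(** A bounded velocity is killed by a density tending to 0, both in [rho u] and in [rho u^2]; this
    is why [u0] may be arbitrary. *)
Lemma flow_cvg_vacuum {K : Type} (F : (K -> Prop) -> Prop) {FF : Filter F}
    (rho u : K -> R) (u0 M : R) :
  filterlim rho F (locally 0) -> F (fun k => Rabs (u k) <= M) ->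
  flow_cvg F rho u 0 u0.
Proof.
intros Hr Hb; split; [exact Hr|split; [intros H; now elim H|]].
rewrite !Rmult_0_l; split.
- now apply filterlim_mult_bounded_0 with M.
- apply filterlim_mult_bounded_0 with (M ^ 2); [exact FF|exact Hr|].
  revert Hb; apply filter_imp; intros k Hk.
  rewrite <- RPow_abs; apply pow_incr; split; [apply Rabs_pos | exact Hk].
Qed.

(** * Wave integrals between positive densities *)

Lemma continuous_w_div (mu k1 k2 s : R) :
  0 < mu -> 0 < s -> continuous (fun s => w mu k1 k2 s / s) s.
Proof.
intros Hmu Hs; unfold Rdiv at 1.
apply (continuous_mult (w mu k1 k2) Rinv).
- apply continuous_sqrt_comp.
  apply (ex_derive_continuous (fun x => k1 / x ^ 2 + k2 ^ 2 * x / mu)).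
  auto_derive; repeat split; nra.
- apply continuous_Rinv; lra.
Qed.

Lemma ex_wave_int (mu k1 k2 a b : R) :
  0 < mu -> 0 < a -> 0 < b -> ex_RInt (fun s => w mu k1 k2 s / s) a b.
Proof.
intros Hmu Ha Hb; apply (ex_RInt_continuous (fun s => w mu k1 k2 s / s)).
intros s [Hs _]; apply continuous_w_div; [exact Hmu|].
apply Rlt_le_trans with (2 := Hs); now apply Rmin_glb_lt.
Qed.

Lemma wave_int_swap (mu k1 k2 a b : R) :
  0 < mu -> 0 < a -> 0 < b -> wave_int mu k1 k2 a b = - wave_int mu k1 k2 b a.
Proof.
intros Hmu Ha Hb; symmetry; apply (opp_RInt_swap (V := R_CompleteNormedModule)).
now apply ex_wave_int.
Qed.

Lemma wave_int_ge_0 (mu k1 k2 a b : R) :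
  0 < mu -> 0 < a <= b -> 0 <= wave_int mu k1 k2 a b.
Proof.
intros Hmu Hab; apply RInt_ge_0; [lra|apply ex_wave_int; lra|].
intros s Hs; apply Rmult_le_pos; [apply sqrt_pos|].
apply Rlt_le, Rinv_0_lt_compat; lra.
Qed.

Lemma wave_int_le_l (mu k1 k2 a b c : R) :
  0 < mu -> 0 < a <= b -> b <= c ->
  wave_int mu k1 k2 b c <= wave_int mu k1 k2 a c.
Proof.
intros Hmu Hab Hbc.
assert (H : wave_int mu k1 k2 a b + wave_int mu k1 k2 b c = wave_int mu k1 k2 a c).
{ apply (RInt_Chasles (V := R_CompleteNormedModule)); apply ex_wave_int; lra. }
pose proof (wave_int_ge_0 mu k1 k2 a b Hmu Hab); lra.
Qed.

(** * Smallness of the speed and of the wave integrals *)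

Instance k_to_0_filter : Filter k_to_0.
Proof. unfold k_to_0; apply within_filter; apply locally_filter. Qed.

Lemma k_to_0_box (d : R) :
  0 < d -> k_to_0 (fun k => 0 < fst k < d /\ 0 < snd k < d).
Proof.
intros Hd; exists (mkposreal d Hd); intros [k1 k2] [H1 H2] [P1 P2]; simpl in *.
change (Rabs (k1 - 0) < d) in H1; change (Rabs (k2 - 0) < d) in H2.
apply Rabs_def2 in H1; apply Rabs_def2 in H2; lra.
Qed.

Lemma w_uniformly_small (mu e M c : R) :
  0 < mu -> 0 < e -> 0 < M -> 0 < c ->
  k_to_0 (fun k => forall s, e <= s <= M -> w mu (fst k) (snd k) s <= c).
Proof.
intros Hmu He HM Hc.
assert (Hc2 : 0 < c ^ 2) by now apply pow_lt.
assert (He2 : 0 < e ^ 2) by now apply pow_lt.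
(* Each term under the root gets half of [c ^ 2]: [k1 / s ^ 2] is worst at [s = e], which gives
   [d1], and [k2 ^ 2 * s / mu] at [s = M], which gives [d2]. The bound 1 on [k2] yields
   [k2 ^ 2 <= k2 < d2]. *)
set (d1 := c ^ 2 * e ^ 2 / 2); set (d2 := c ^ 2 * mu / (2 * M)).
assert (0 < d1) by (unfold d1; nra).
assert (0 < d2) by (apply Rdiv_lt_0_compat; nra).
assert (Hd : 0 < Rmin 1 (Rmin d1 d2)) by (repeat apply Rmin_glb_lt; lra).
generalize (k_to_0_box _ Hd); apply filter_imp.
intros [k1 k2]; simpl; intros [[P1 H1] [P2 H2]] s Hs.
pose proof (Rmin_l 1 (Rmin d1 d2)); pose proof (Rmin_r 1 (Rmin d1 d2)).
pose proof (Rmin_l d1 d2); pose proof (Rmin_r d1 d2).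
unfold w; rewrite <- (sqrt_pow2 c) by lra; apply sqrt_le_1_alt.
assert (e ^ 2 <= s ^ 2) by (apply pow_incr; lra).
assert (k1 / s ^ 2 <= c ^ 2 / 2).
{ apply Rle_div_l; [lra|]; unfold d1 in *; nra. }
assert (Hk : k2 ^ 2 <= d2) by nra.
assert (k2 ^ 2 * s / mu <= c ^ 2 / 2); [|lra].
apply Rle_div_l; [lra|].
apply Rle_trans with (d2 * M).
- apply Rmult_le_compat; [apply pow2_ge_0| | |]; lra.
- right; unfold d2; field; lra.
Qed.

Lemma wave_int_uniformly_small (mu e M c : R) :
  0 < mu -> 0 < e -> 0 < M -> 0 < c ->
  k_to_0 (fun k => forall a b, e <= a <= b -> b <= M ->
    wave_int mu (fst k) (snd k) a b <= c).
Proof.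
intros Hmu He HM Hc.
(* With [w <= c * e / M] and [s >= e], the integrand is at most [c / M], over an interval of length
   at most [M]. *)
assert (Hc' : 0 < c * e / M) by (apply Rdiv_lt_0_compat; nra).
generalize (w_uniformly_small mu e M _ Hmu He HM Hc'); apply filter_imp.
intros [k1 k2]; simpl; intros Hw a b Ha Hb.
assert (HI : wave_int mu k1 k2 a b <= RInt (fun _ => c / M) a b).
{ apply RInt_le; [lra|apply ex_wave_int; lra|apply ex_RInt_const|].
  intros s Hs; apply Rle_div_l; [lra|].
  apply Rle_trans with (1 := Hw s ltac:(lra)).
  replace (c * e / M) with (c / M * e) by (field; lra).
  apply Rmult_le_compat_l; [apply Rlt_le, Rdiv_lt_0_compat|]; lra. }
rewrite RInt_const in HI; change (scal (b - a) (c / M)) with ((b - a) * (c / M)) in HI.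
apply Rle_trans with (1 := HI).
apply Rle_trans with (M * (c / M)); [|right; field; lra].
apply Rmult_le_compat_r; [apply Rlt_le, Rdiv_lt_0_compat|]; lra.
Qed.

(** Solutions are only given for data in the region; this makes them available for all small
    parameters. It holds because the wave integral between the two fixed densities drops below the
    positive gap [up - um]. *)
Lemma region_I_eventually (mu rhom rhop um up : R) :
  0 < mu -> 0 < rhom -> 0 < rhop -> um < up ->
  k_to_0 (fun k => region_I mu (fst k) (snd k) rhom um rhop up).
Proof.
intros Hmu Hm Hp Hu.
assert (Hmin : 0 < Rmin rhom rhop) by now apply Rmin_glb_lt.
assert (HM : 0 < rhom + rhop) by lra.
assert (Hc : 0 < (up - um) / 2) by lra.
generalize (wave_int_uniformly_small mu _ _ _ Hmu Hmin HM Hc); apply filter_imp.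
intros [k1 k2] H; simpl in *; split; [exact Hp|].
pose proof (Rmin_l rhom rhop); pose proof (Rmin_r rhom rhop).
destruct (Rle_dec rhom rhop) as [L|L].
- specialize (H rhom rhop ltac:(lra) ltac:(lra)).
  pose proof (wave_int_ge_0 mu k1 k2 rhom rhop Hmu ltac:(lra)).
  rewrite Rabs_pos_eq; lra.
- specialize (H rhop rhom ltac:(lra) ltac:(lra)).
  pose proof (wave_int_ge_0 mu k1 k2 rhop rhom Hmu ltac:(lra)).
  rewrite wave_int_swap, Rabs_Ropp, Rabs_pos_eq by lra; lra.
Qed.

(** * The fan at a fixed interior [xi], and the limit *)

(** On [R1], [xi = u - w] and [u - um] is the integral from the density up to [rhom], so that
    integral is [xi - um + w], at least [xi - um]. On [R2] it is symmetric. *)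
Lemma two_rarefaction_inner (mu k1 k2 rhom um rhop up : R) (rho u : R -> R) (xi : R) :
  0 < mu -> um < xi < up ->
  two_rarefaction_solution mu k1 k2 rhom um rhop up rho u ->
  0 < rho xi <= Rmax rhom rhop /\ um <= u xi <= up /\
  (rho xi <= rhom /\ xi - um <= wave_int mu k1 k2 (rho xi) rhom \/
   rho xi <= rhop /\ up - xi <= wave_int mu k1 k2 (rho xi) rhop).
Proof.
intros Hmu Hxi (rs & us & [Hr0 Hr] & E1 & E2 & _ & W1 & Mid & W2 & _).
pose proof (Rmin_l rhom rhop); pose proof (Rmin_r rhom rhop).
pose proof (Rmax_l rhom rhop); pose proof (Rmax_r rhom rhop).
assert (Hw : forall s, 0 <= w mu k1 k2 s) by (intros s; apply sqrt_pos).
(* Oriented upwards the integrals are nonnegative, so [um <= us <= up]. *)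
rewrite wave_int_swap in E1, E2 by lra.
pose proof (wave_int_ge_0 mu k1 k2 rs rhom Hmu ltac:(lra)).
pose proof (wave_int_ge_0 mu k1 k2 rs rhop Hmu ltac:(lra)).
destruct (Rle_dec xi (lambda1 mu k1 k2 rs us)) as [L1|L1].
{ assert (Hl : lambda1 mu k1 k2 rhom um <= xi)
    by (unfold lambda1; specialize (Hw rhom); lra).
  destruct (W1 xi (conj Hl L1)) as (B & Ex & Eu).
  rewrite wave_int_swap in Eu by lra.
  pose proof (wave_int_ge_0 mu k1 k2 (rho xi) rhom Hmu ltac:(lra)).
  pose proof (wave_int_le_l mu k1 k2 rs (rho xi) rhom Hmu ltac:(lra) ltac:(lra)).
  unfold lambda1 in Ex; specialize (Hw (rho xi)).
  repeat split; lra. }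
destruct (Rle_dec xi (lambda2 mu k1 k2 rs us)) as [L2|L2].
(* Here [us - um] and [up - us] are the two integrals from [rs]: the first alternative holds if
   [xi <= us], the second otherwise. *)
{ destruct (Mid xi ltac:(lra)) as [Er Eu]; rewrite Er, Eu.
  repeat split; lra. }
assert (Hl : xi <= lambda2 mu k1 k2 rhop up)
  by (unfold lambda2; specialize (Hw rhop); lra).
destruct (W2 xi ltac:(lra)) as (B & Ex & Eu).
rewrite wave_int_swap in Eu by lra.
pose proof (wave_int_ge_0 mu k1 k2 (rho xi) rhop Hmu ltac:(lra)).
pose proof (wave_int_le_l mu k1 k2 rs (rho xi) rhop Hmu ltac:(lra) ltac:(lra)).
unfold lambda2 in Ex; specialize (Hw (rho xi)).
repeat split; lra.
Qed.

Theorem theorem4 (mu rhom rhop um up : R)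
    (Hmu : 0 < mu) (Hrhom : 0 < rhom) (Hrhop : 0 < rhop) (Hu : um < up)
    (rho u : R -> R -> R -> R)
    (Hsol : forall k1 k2 : R, 0 < k1 -> 0 < k2 ->
       region_I mu k1 k2 rhom um rhop up ->
       two_rarefaction_solution mu k1 k2 rhom um rhop up (rho k1 k2) (u k1 k2)) :
  forall xi : R, xi <> um -> xi <> up ->
    flow_cvg k_to_0
      (fun k => rho (fst k) (snd k) xi)
      (fun k => u (fst k) (snd k) xi)
      (transport_rho rhom um rhop up xi)
      (transport_u um up xi).
Proof.
intros xi Nm Np.
assert (Sol : k_to_0 (fun k =>
  two_rarefaction_solution mu (fst k) (snd k) rhom um rhop up
    (rho (fst k) (snd k)) (u (fst k) (snd k)))).
{ generalize (filter_and _ _ (k_to_0_box 1 Rlt_0_1)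
    (region_I_eventually mu rhom rhop um up Hmu Hrhom Hrhop Hu)).
  apply filter_imp; intros k [[H1 H2] HI]; apply Hsol; [lra|lra|exact HI]. }
unfold transport_rho, transport_u.
destruct (Rlt_dec xi um) as [Lm|Lm]; [|destruct (Rle_dec xi up) as [Lp|Lp]].
- apply flow_cvg_eventually_eq; [exact _|].
  generalize (filter_and _ _ Sol
    (* On the single density [rhom], [w <= um - xi] puts [xi] left of the first fan edge. *)
    (w_uniformly_small mu rhom rhom (um - xi) Hmu Hrhom Hrhom ltac:(lra))).
  apply filter_imp; intros k [(rs & us & _ & _ & _ & H & _) Hw].
  apply H; specialize (Hw rhom ltac:(lra)); unfold lambda1; lra.
- assert (Hxi : um < xi < up) by lra.
  apply flow_cvg_vacuum with (Rmax (Rabs um) (Rabs up)); [exact _| |].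
  + apply filterlim_locally; intros eps.
    set (c := Rmin (xi - um) (up - xi)).
    assert (Hc : 0 < c) by (apply Rmin_glb_lt; lra).
    (* If the density were at least [eps], both candidate integrals would lie over part of
       [[eps, rhom + rhop]], hence be at most [c / 2], whereas one of them is at least [c]. *)
    generalize (filter_and _ _ Sol (wave_int_uniformly_small mu eps (rhom + rhop)
      (c / 2) Hmu (cond_pos eps) ltac:(lra) ltac:(lra))).
    apply filter_imp; intros k [S HI].
    destruct (two_rarefaction_inner _ _ _ _ _ _ _ _ _ xi Hmu Hxi S)
      as (Hr & _ & Hi).
    change (Rabs (rho (fst k) (snd k) xi - 0) < eps).
    rewrite Rminus_0_r, Rabs_pos_eq by lra.
    apply Rnot_le_lt; intros Le.
    pose proof (Rmin_l (xi - um) (up - xi) : c <= _).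
    pose proof (Rmin_r (xi - um) (up - xi) : c <= _).
    destruct Hi as [[Hl Hi]|[Hl Hi]].
    * specialize (HI (rho (fst k) (snd k) xi) rhom ltac:(lra) ltac:(lra)); lra.
    * specialize (HI (rho (fst k) (snd k) xi) rhop ltac:(lra) ltac:(lra)); lra.
  + revert Sol; apply filter_imp; intros k S.
    destruct (two_rarefaction_inner _ _ _ _ _ _ _ _ _ xi Hmu Hxi S)
      as (_ & Hb & _).
    apply RmaxAbs; lra.
- apply flow_cvg_eventually_eq; [exact _|].
  generalize (filter_and _ _ Sol
    (w_uniformly_small mu rhop rhop (xi - up) Hmu Hrhop Hrhop ltac:(lra))).
  apply filter_imp; intros k [(rs & us & _ & _ & _ & _ & _ & _ & _ & H) Hw].
  apply H; specialize (Hw rhop ltac:(lra)); unfold lambda2; lra.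
Qed.
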